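(* Let $p$ be a prime. If $E_p=\{x\in\mathbb{T}: m_p(x)>0\}$ is non-empty, then $\mathcal{H}^{h_1}(E_p)>0$ and $E_p$ has the cardinality of the continuum.
   Context: $\mathbb{T}=\mathbb{R}/\mathbb{Z}$ is the circle with its usual metric. For real $t$, $\|t\|$ is the distance from $t$ to $\mathbb{Z}$; for a positive integer $q$ and $x\in\mathbb{T}$, $\|qx\|$ is well defined. $|\cdot|_p$ is the $p$-adic absolute value with $|p|_p=p^{-1}$. Put $m_p(x)=\liminf_{q\to\infty}q\,|q|_p\,\|qx\|$, with $q$ ranging over positive integers. For a gauge function $h$ (continuous non-decreasing $h:[0,\infty)\to[0,\infty)$ with $h(0)=0$ and $h(r)>0$ for $r>0$), a subset $E$ of a metric space and $\delta>0$, $\mathcal{H}^h_\delta(E)=\inf\{\sum_i h(\operatorname{diam}U_i): E\subseteq\bigcup_i U_i,\ \operatorname{diam}U_i\le\delta\}$, the infimum being over countable covers, and $\mathcal{H}^h(E)=\lim_{\delta\to0}\mathcal{H}^h_\delta(E)$. The gauge $h_1$ is $h_1(r)=1/\log(1/r)$ for $0<r<e^{-1}$, $h_1(0)=0$, extended away from zero in any continuous non-decreasing way. *)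

(* Defs.v *)
From HB Require Import structures.
From mathcomp Require Import all_boot all_order all_algebra.
From mathcomp Require Import generic_quotient ring_quotient.
From mathcomp Require Import all_classical all_reals all_analysis.

Set Implicit Arguments.
Unset Strict Implicit.
Unset Printing Implicit Defensive.

Import Order.TTheory GRing.Theory Num.Theory.
Import numFieldNormedType.Exports.

Local Open Scope classical_set_scope.
Local Open Scope ring_scope.
Local Open Scope quotient_scope.

Section distZ.
Context {R : realType}.
Implicit Types t u : R.

Definition distZ (t : R) : R := inf [set `|t - z%:~R| | z in [set: int]].

Lemma distZ_has_inf t : has_inf [set `|t - z%:~R| | z in [set: int]].
Proof.
split; first by exists `|t - 0%:~R|, 0.
by exists 0 => _ [z _ <-].
Qed.

Lemma distZ_le t (z : int) : distZ t <= `|t - z%:~R|.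
Proof. by apply: ge_inf; [exact: (distZ_has_inf t).2 | exists z]. Qed.

Lemma distZ_ge t (a : R) :
  (forall z : int, a <= `|t - z%:~R|) -> a <= distZ t.
Proof.
move=> h; apply: lb_le_inf; first exact: (distZ_has_inf t).1.
by move=> _ [z _ <-].
Qed.

Lemma distZ_ge0 t : 0 <= distZ t.
Proof. by apply: distZ_ge. Qed.

Lemma distZ_intr (z : int) : distZ (z%:~R : R) = 0.
Proof.
by apply/eqP; rewrite eq_le distZ_ge0 andbT (le_trans (distZ_le _ z))// subrr normr0.
Qed.

Lemma distZDint t (z : int) : distZ (t + z%:~R) = distZ t.
Proof.
apply/eqP; rewrite eq_le; apply/andP; split; apply: distZ_ge => w.
- by rewrite (le_trans (distZ_le _ (w + z)))// intrD opprD addrACA subrr addr0.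
- by rewrite (le_trans (distZ_le _ (w - z)))// intrB opprB addrA.
Qed.

Lemma distZN t : distZ (- t) = distZ t.
Proof.
apply/eqP; rewrite eq_le; apply/andP; split; apply: distZ_ge => w.
- by rewrite (le_trans (distZ_le _ (- w)))// intrN -opprD normrN.
- by rewrite (le_trans (distZ_le _ (- w)))// intrN -normrN opprD opprK.
Qed.

Lemma distZD t u : distZ (t + u) <= distZ t + distZ u.
Proof.
rewrite -lerBlDr; apply: distZ_ge => z; rewrite lerBlDr -lerBlDl.
apply: distZ_ge => w; rewrite lerBlDl.
by rewrite (le_trans (distZ_le _ (z + w)))// intrD opprD addrACA ler_normD.
Qed.

Lemma distZ_eq0 t : distZ t = 0 -> t \is a Num.int.
Proof.
move=> t0.
have /(_ 2^-1) : forall e : R, 0 < e -> exists z : int, `|t - z%:~R| < e.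
  move=> e e0; have [_ [z _ <-] ze] := inf_adherent e0 (distZ_has_inf t).
  by exists z; move: ze; rewrite -/(distZ t) t0 add0r.
case=> [|z z2]; first by rewrite invr_gt0.
have [->|tz] := eqVneq t z%:~R; first by apply/intrP; exists z.
have d0 : 0 < `|t - z%:~R| by rewrite normr_gt0 subr_eq0.
have [_ [w _ <-] wd] := inf_adherent d0 (distZ_has_inf t).
rewrite -/(distZ t) t0 add0r in wd.
have : `|(z - w)%:~R : R| < 1.
  rewrite intrB -(subrKA t) (le_lt_trans (ler_normD _ _))// distrC.
  by have := ltrD z2 (lt_trans wd z2); rewrite -[2^-1]mul1r -splitr.
rewrite -intr_norm (_ : 1 = 1%:~R)// ltr_int => zw.
have /eqP : z = w by apply/eqP; rewrite -subr_eq0 -normr_le0 -ltzD1 add0r.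
by move=> /eqP zw'; rewrite zw' ltxx in wd.
Qed.

End distZ.

Definition integers (R : realType) : {pred R} := fun x => x \is a Num.int.

Lemma integers_zmod_closed (R : realType) : zmod_closed (@integers R).
Proof. by split=> [|x y]; [exact: rpred0|exact: rpredB]. Qed.

HB.instance Definition _ (R : realType) :=
  GRing.isZmodClosed.Build R (@integers R) (@integers_zmod_closed R).

Definition circle (R : realType) := Quotient.quot (@integers R).

HB.instance Definition _ (R : realType) := GRing.Zmodule.on (circle R).
HB.instance Definition _ (R : realType) := EqQuotient.on (circle R).

Section circle.
Context {R : realType}.
Implicit Types (t : R) (x y z : circle R).

(* [repr] picks an arbitrary real lift of [x]; the value does not depend on the
   lift, see [circle_norm_pi]. *)
Definition circle_norm x : R := distZ (repr x).

Lemma circle_norm_pi t : circle_norm (\pi_(circle R) t) = distZ t.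
Proof.
rewrite /circle_norm.
have : repr (\pi_(circle R) t) - t \in @integers R.
  by rewrite Quotient.idealrBE reprK.
by move=> /intrP[z /eqP]; rewrite subr_eq addrC => /eqP ->; rewrite distZDint.
Qed.

Lemma circle_norm_pi_mulrn t (q : nat) :
  circle_norm (\pi_(circle R) t *+ q) = distZ (q%:R * t).
Proof.
rewrite mulr_natl -circle_norm_pi; congr circle_norm.
elim: q => [|q IHq]; first by rewrite !mulr0n pi_zeror.
by rewrite !mulrS IHq pi_addr.
Qed.

Definition circle_dist x y : R := circle_norm (x - y).

Lemma circle_dist_pi t u :
  circle_dist (\pi_(circle R) t) (\pi_(circle R) u) = distZ (t - u).
Proof. by rewrite -circle_norm_pi pi_addr pi_oppr. Qed.

Lemma circle_distxx x : circle_dist x x = 0.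
Proof. by rewrite -(reprK x) circle_dist_pi subrr (distZ_intr 0). Qed.

Lemma circle_dist_positivity x y : circle_dist x y = 0 -> x = y.
Proof.
rewrite -(reprK x) -(reprK y) circle_dist_pi => /distZ_eq0 xy.
by apply/eqP; rewrite -Quotient.idealrBE.
Qed.

Lemma circle_dist_sym x y : circle_dist x y = circle_dist y x.
Proof. by rewrite -(reprK x) -(reprK y) !circle_dist_pi -distZN opprB. Qed.

Lemma circle_dist_triangle y x z :
  circle_dist x z <= circle_dist x y + circle_dist y z.
Proof.
rewrite -(reprK x) -(reprK y) -(reprK z) !circle_dist_pi.
by rewrite -(subrKA (repr y)) distZD.
Qed.

HB.instance Definition _ := isMetric.Build R (circle R)
  circle_distxx circle_dist_positivity circle_dist_sym circle_dist_triangle.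

End circle.

Definition padic_abs (R : realType) (p q : nat) : R :=
  if q == 0%N then 0 else p%:R ^- logn p q.

Definition mp (R : realType) (p : nat) (x : circle R) : \bar R :=
  limn_einf (fun n => (n.+1%:R * padic_abs R p n.+1 *
                       circle_norm (x *+ n.+1))%:E).

Definition Ep (R : realType) (p : nat) : set (circle R) :=
  [set x | (0 < mp p x)%E].

Arguments Ep R p%_nat_scope : clear implicits.

(* [h] is only constrained on [0, +oo[: its values at negative reals are junk *)
Definition gauge_function (R : realType) (h : R -> R) : Prop :=
  [/\ {within `[0, +oo[, continuous h},
      {in `[0, +oo[ &, {homo h : r s / r <= s}},
      h 0 = 0 &
      forall r : R, 0 < r -> 0 < h r].

Definition gauge_h1 (R : realType) (h : R -> R) : Prop :=
  gauge_function h /\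
  forall r : R, 0 < r < expR (- 1) -> h r = (ln r^-1)^-1.

Section hausdorff_measure.
Context {R : realType} {T : metricType R}.
Local Open Scope ereal_scope.

(* 0 is adjoined so that the empty set has diameter 0 instead of -oo *)
Definition diam (A : set T) : \bar R :=
  ereal_sup (0 |` [set (mdist x y)%:E | x in A & y in A]).

(* covers by finitely many sets are included: set0 has diameter 0 and a gauge
   function vanishes at 0 *)
Definition hausdorff_premeasure (h : R -> R) (delta : R) (E : set T) : \bar R :=
  ereal_inf [set \sum_(i <oo) (h (fine (diam (U i))))%:E | U in
    [set U : (set T)^nat | E `<=` \bigcup_i U i /\
                           forall i, diam (U i) <= delta%:E]].

Definition hausdorff_measure (h : R -> R) (E : set T) : \bar R :=
  lim (hausdorff_premeasure h delta E @[delta --> 0^'+]).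

End hausdorff_measure.

(* Main.v *)
Require Import Defs.
From mathcomp Require Import all_boot all_order all_algebra.
From mathcomp Require Import generic_quotient ring_quotient.
From mathcomp Require Import all_classical all_reals all_analysis.
From mathcomp Require Import lra.

(** Replacing [x] by [p ^ k x] only passes to a subsequence of the quantities
    [q |q|_p ||q x||], so a point of [E_p] can be multiplied by a power of [p]
    until the bound [c <= q |q|_p ||q x||], with some [c > 0], holds for every
    [q > 0] ([Ep_uniformly_bad]).  The set of points satisfying this bound is
    closed, invariant under multiplication by [p], and contained in [E_p]
    ([uniformly_bad_closed], [uniformly_bad_expM], [uniformly_bad_Ep]).

    The key point is that the orbit [p ^ k x] returns slowly.  If two visits to
    a set of diameter at most [r] happen at times [k] and [k + d], take
    [q = p ^ (k + d) - p ^ k = p ^ k (p ^ d - 1)]; since [|q|_p = p ^ - k], the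
    bound says that [c <= (p ^ d - 1) r], hence [d] exceeds
    [log (c / r) / log p] ([uniformly_bad_return]).  Hence the set of visiting
    times has upper density at most about [log p / log (1 / r)], which is
    a constant multiple of [h_1 (r)].

    A distribution function turns this into both conclusions.  Let [F t] be the
    upper density of the times at which the orbit lies in [0, t[.  Then [F] is
    nondecreasing from [0] to [1], its increments are bounded by the gauge
    ([orbit_cdf_gauge]), so that it is continuous, and it can increase only at
    points of the closure of the orbit, all of which lie in [E_p].  Therefore [F]
    maps [E_p] onto a set containing ]0, 1[ ([orbit_cdf_surj]).  This gives
    the cardinality at once, and also the measure: the image under [F] of a piece
    of diameter [r] lies in two intervals of length [O (h_1 (r))], and countably
    many such intervals can cover ]0, 1[ only if their lengths add up to at least
    [1] ([mass_distribution]). *)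

Import Order.TTheory GRing.Theory Num.Theory.
Import numFieldNormedType.Exports.

Local Open Scope classical_set_scope.
Local Open Scope ring_scope.
Local Open Scope quotient_scope.

(** * Coordinates on the circle *)

Section coordinate.
Context {R : realType}.
Implicit Types (t s : R) (x y : circle R).

(** The representative in [0, 1[. *)
Definition circle_coord x : R := repr x - (Num.floor (repr x))%:~R.

Lemma circle_coord_ge0 x : 0 <= circle_coord x.
Proof. by rewrite subr_ge0 ge_floor. Qed.

Lemma circle_coord_lt1 x : circle_coord x < 1.
Proof.
by have := lt_succ_floor (repr x); rewrite /circle_coord intrD => h; rewrite ltrBlDl.
Qed.

Lemma pi_intr (z : int) : \pi_(circle R) z%:~R = 0.
Proof.
apply: circle_dist_positivity.
by rewrite -pi_zeror circle_dist_pi subr0 distZ_intr.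
Qed.

Lemma circle_coordK x : \pi_(circle R) (circle_coord x) = x.
Proof. by rewrite /circle_coord pi_addr pi_oppr pi_intr subr0 reprK. Qed.

Lemma circle_coord_pi t : 0 <= t -> t < 1 -> circle_coord (\pi_(circle R) t) = t.
Proof.
move=> t0 t1; apply/eqP; rewrite -subr_eq0.
have /intrP[z zE] : circle_coord (\pi_(circle R) t) - t \is a Num.int.
  by apply: distZ_eq0; rewrite -circle_dist_pi circle_coordK circle_distxx.
have unit_diff (a : R) : 0 <= a -> a < 1 -> `|a - t| < 1.
  by move=> a0 a1; rewrite ltr_norml; apply/andP; split; lra.
have := unit_diff _ (circle_coord_ge0 (\pi_(circle R) t)) (circle_coord_lt1 _); rewrite zE => z1.
rewrite intr_eq0 -normr_le0 -ltzD1 add0r -(ltr_int R).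
by rewrite intr_norm.
Qed.

Lemma circle_dist_coord x y : mdist x y = distZ (circle_coord x - circle_coord y).
Proof. by rewrite -circle_dist_pi !circle_coordK. Qed.

Lemma circle_norm_dist x y : circle_norm x <= circle_norm y + mdist x y.
Proof.
have h z : circle_norm z = mdist z 0 by rewrite /mdist/= /circle_dist subr0.
by rewrite !h addrC metric_triangle.
Qed.

Lemma distZ_le_norm t : distZ t <= `|t|.
Proof. by rewrite (le_trans (distZ_le t 0))// subr0. Qed.

(** On an arc of length at most one half the circle metric is the metric of the
    coordinate: a nonzero integer is at distance at least one half from [t]. *)
Lemma distZ_half t : `|t| <= 1 / 2 -> distZ t = `|t|.
Proof.
move=> t2; apply/eqP; rewrite eq_le distZ_le_norm distZ_ge// => z.
have [->|z0] := eqVneq z 0; first by rewrite subr0.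
have : 1 <= `|z%:~R : R|.
  by rewrite -intr_norm (_ : 1 = 1%:~R)// ler_int -gtz0_ge1 normr_gt0.
have := ler_normD (z%:~R - t) t; rewrite subrK distrC; lra.
Qed.

Lemma distZ_mulrn t (q : nat) : distZ (q%:R * t) <= q%:R * distZ t.
Proof.
elim: q => [|q IH]; first by rewrite !mul0r (distZ_intr 0).
by rewrite -natr1 !mulrDl !mul1r (le_trans (distZD _ _))// lerD.
Qed.

Lemma circle_norm_mulrn x (q : nat) : circle_norm (x *+ q) <= q%:R * circle_norm x.
Proof. by rewrite -(circle_coordK x) circle_norm_pi_mulrn circle_norm_pi distZ_mulrn. Qed.

End coordinate.

(** * Upper density of sets of times *)

Section density.
Context {R : realType}.
Implicit Types A B C : pred nat.

Definition frequency A (n : nat) : R := (count A (iota 0 n.+1))%:R / n.+1%:R.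

(** The infimum of the eventual upper bounds of a bounded sequence is its limit
    superior. *)
Definition upper_density A : R :=
  inf [set b | \forall n \near \oo, frequency A n <= b].

Lemma frequency_ge0 A n : 0 <= frequency A n.
Proof. by rewrite divr_ge0. Qed.

Lemma frequency_le1 A n : frequency A n <= 1.
Proof.
rewrite ler_pdivrMr// mul1r ler_nat.
by rewrite (leq_trans (count_size _ _))// size_iota.
Qed.

Lemma upper_density_has_inf A :
  has_inf [set b | \forall n \near \oo, frequency A n <= b].
Proof.
split; first by exists 1; apply: nearW => n; exact: frequency_le1.
exists 0 => b -[N _ h].
by rewrite (le_trans (frequency_ge0 A N))// h//=.
Qed.

Lemma upper_densityT : upper_density predT = 1.
Proof.
have f1 n : frequency predT n = 1.
  by rewrite /frequency count_predT size_iota divff.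
apply/eqP; rewrite eq_le; apply/andP; split.
  apply: ge_inf; first exact: (upper_density_has_inf _).2.
  by apply: nearW => n; rewrite f1.
apply: lb_le_inf; first exact: (upper_density_has_inf _).1.
by move=> b [N _ /(_ N)/=]; rewrite f1; apply.
Qed.

Lemma upper_density0 : upper_density pred0 = 0.
Proof.
have f1 n : frequency pred0 n = 0.
  by rewrite /frequency count_pred0 mul0r.
apply/eqP; rewrite eq_le; apply/andP; split.
  apply: ge_inf; first exact: (upper_density_has_inf _).2.
  by apply: nearW => n; rewrite f1.
apply: lb_le_inf; first exact: (upper_density_has_inf _).1.
by move=> b [N _ /(_ N)/=]; rewrite f1; apply.
Qed.

Lemma upper_density_sub A B : {subset A <= B} -> upper_density A <= upper_density B.
Proof.
move=> AB; apply: lb_le_inf; first exact: (upper_density_has_inf _).1.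
move=> b [N _ h]; apply: ge_inf; first exact: (upper_density_has_inf _).2.
exists N => // n /h; apply: le_trans.
by rewrite ler_pM2r ?invr_gt0// ler_nat sub_count//.
Qed.

(** Consecutive elements of [C] are at least [g.+1] apart, so each block of
    [g.+1] consecutive times contains at most one of them: [k %/ g.+1] is
    injective on [C]. *)
Lemma sparse_count C (g N : nat) :
  (forall k d, C k -> C (k + d)%N -> (0 < d)%N -> (g < d)%N) ->
  (count C (iota 0 N.+1) <= (N %/ g.+1).+1)%N.
Proof.
move=> gap; rewrite -size_filter -(size_map (divn^~ g.+1)).
rewrite -[leqRHS](size_iota 0); apply: uniq_leq_size.
  rewrite map_inj_in_uniq; first by rewrite filter_uniq// iota_uniq.
  suff close k l : (k < l)%N -> C k -> C l -> (k %/ g.+1 < l %/ g.+1)%N.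
    move=> k l; rewrite !mem_filter /= => /andP[Ck _] /andP[Cl _] kl.
    case: (ltngtP k l) => // [/close/(_ Ck Cl)|/close/(_ Cl Ck)]; by rewrite kl ltnn.
  move=> kl Ck Cl; have gl : (g < l - k)%N.
    by apply: (gap k); rewrite ?subnKC ?subn_gt0// ltnW.
  rewrite -addn1 -divnDMl// mul1n leq_div2r// addnC.
  by rewrite (leq_trans (leq_add gl (leqnn k)))// subnK// ltnW.
move=> _ /mapP[k + ->]; rewrite mem_filter !mem_iota !add0n => /andP[_].
rewrite !ltnS => /andP[_ kN].
by rewrite leq_div2r.
Qed.

(** Upper density is subadditive, and a set with gaps at least [g.+1] has density
    at most [1 / (g + 1)]; the surplus of one element in the count contributes
    [1 / (n + 1)] to the frequency, which vanishes in the limit. *)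
Lemma upper_density_sparse A B C (g : nat) :
  (forall k, A k -> B k || C k) ->
  (forall k d, C k -> C (k + d)%N -> (0 < d)%N -> (g < d)%N) ->
  upper_density A <= upper_density B + g.+1%:R^-1.
Proof.
move=> ABC gap; rewrite -lerBlDr.
apply: lb_le_inf; first exact: (upper_density_has_inf _).1.
move=> b hb; rewrite lerBlDr; apply/ler_addgt0Pr => e e0.
apply: ge_inf; first exact: (upper_density_has_inf _).2.
near=> n.
have fB : frequency B n <= b by near: n.
have ne : n.+1%:R^-1 <= e by near: n; apply: filterS (near_infty_natSinv_lt (PosNum e0)) => n; exact: ltW.
have cnt : (count A (iota 0 n.+1) <= count B (iota 0 n.+1) + (n %/ g.+1).+1)%N.
  apply: leq_trans (leq_add (leqnn _) (@sparse_count C g n gap)).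
  by rewrite -count_predUI (leq_trans _ (leq_addr _ _))// sub_count.
apply: le_trans (lerD (lerD fB (lexx _)) ne).
rewrite /frequency ler_pdivrMr// !mulrDl divfK// mulVf//.
apply: (@le_trans _ _ (count B (iota 0 n.+1) + (n %/ g.+1).+1)%:R).
  by rewrite ler_nat.
rewrite natrD -addrA lerD2l -natr1 lerD2r mulrC ler_pdivlMr// -natrM ler_nat.
by rewrite (leq_trans (leq_trunc_div _ _)).
Unshelve. all: by end_near. Qed.

End density.

(** * Uniformly bad points *)

Section uniformly_bad.
Context {R : realType} {p : nat} (p_pr : prime p).
Implicit Types (c r e : R) (x y : circle R) (q k d g : nat).

Definition weight q : R := q%:R * padic_abs R p q.

Lemma weight_ge0 q : 0 <= weight q.
Proof. by rewrite mulr_ge0// /padic_abs; case: ifP => // _; rewrite invr_ge0 exprn_ge0. Qed.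

Lemma weight_le q : weight q <= q%:R.
Proof.
rewrite ler_piMr// /padic_abs; case: ifP => // _.
by rewrite invf_le1 ?exprn_gt0// ?ltr0n ?prime_gt0// exprn_ege1// ler1n prime_gt0.
Qed.

(** The factor [p ^ k] is cancelled by its [p]-adic absolute value.  This is what
    makes the set of uniformly bad points invariant under multiplication by [p]. *)
Lemma weight_expM k q : (0 < q)%N -> weight (p ^ k * q) = weight q.
Proof.
move=> q0; have p0 : p%:R != 0 :> R by rewrite pnatr_eq0 -lt0n prime_gt0.
rewrite /weight /padic_abs muln_eq0 expn_eq0 !eqn0Ngt prime_gt0// q0/=.
rewrite lognM ?expn_gt0 ?(prime_gt0 p_pr)// pfactorK// exprD invfM natrM natrX.
by rewrite mulrACA divff ?mul1r// expf_neq0.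
Qed.

Lemma weight_exp_subn k d : (0 < d)%N ->
  weight (p ^ (k + d) - p ^ k) = p%:R ^+ d - 1.
Proof.
move=> d0; have p1 := prime_gt1 p_pr.
have pd1 : (1 < p ^ d)%N by rewrite -{1}(expn0 p) ltn_exp2l.
have q0 : (0 < p ^ d - 1)%N by rewrite subn_gt0.
rewrite expnD -[X in (_ - X)%N]muln1 -mulnBr weight_expM//.
rewrite /weight /padic_abs eqn0Ngt q0/= logn_coprime ?expr0 ?invr1 ?mulr1.
  by rewrite natrB ?natrX// ltnW.
by rewrite -(coprime_pexpl _ _ d0) subn1 coprimenP// ltnW.
Qed.

Definition uniformly_bad c : set (circle R) :=
  [set x | forall q, (0 < q)%N -> c <= weight q * circle_norm (x *+ q)].

Lemma uniformly_bad_expM c x k : uniformly_bad c x -> uniformly_bad c (x *+ p ^ k).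
Proof.
move=> bx q q0; rewrite -mulrnA -(weight_expM k _ q0) bx//.
by rewrite muln_gt0 expn_gt0 prime_gt0.
Qed.

(** For each fixed [q] the function [x |-> ||q x||] is continuous (with Lipschitz
    constant [q]), so each of the defining inequalities is a closed condition. *)
Lemma uniformly_bad_closed c x :
  (forall e, 0 < e -> exists2 y, uniformly_bad c y & mdist y x <= e) ->
  uniformly_bad c x.
Proof.
move=> near_bad q q0; apply/ler_addgt0Pr => e e0.
have q0R : 0 < q%:R :> R by rewrite ltr0n.
have [|y /(_ _ q0) by_q xy] := near_bad (e / (q%:R * q%:R)).
  by rewrite divr_gt0// mulr_gt0.
apply: le_trans by_q _.
have mdist_mulrn : mdist (y *+ q) (x *+ q) <= q%:R * mdist y x.
  by rewrite /mdist/= /circle_dist -mulrnBl circle_norm_mulrn.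
have := ler_wpM2l (weight_ge0 q) (circle_norm_dist (y *+ q) (x *+ q)).
move=> /le_trans; apply; rewrite mulrDr lerD2l.
apply: le_trans (ler_pM _ _ (weight_le q) mdist_mulrn) _ => //.
- exact: weight_ge0.
- exact: mdist_ge0.
by rewrite mulrA mulrC -ler_pdivlMr// mulr_gt0.
Qed.

(** Slow recurrence: the bound for the multiplier [p ^ (k + d) - p ^ k], whose
    weight is [p ^ d - 1], reads [c <= (p ^ d - 1) r], which forces [p ^ g] to
    be smaller than [p ^ d]. *)
Lemma uniformly_bad_return {c x} r k d g : uniformly_bad c x -> 0 < r ->
  r * p%:R ^+ g <= c -> (0 < d)%N ->
  mdist (x *+ p ^ (k + d)) (x *+ p ^ k) <= r -> (g < d)%N.
Proof.
move=> bx r0 rc d0 dr; have p1 := prime_gt1 p_pr.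
have kd : (p ^ k < p ^ (k + d))%N by rewrite ltn_exp2l// -[X in (X < _)%N]addn0 ltn_add2l.
have := bx (p ^ (k + d) - p ^ k)%N; rewrite subn_gt0 => /(_ kd).
rewrite weight_exp_subn// mulrnBr ?(ltnW kd)//.
rewrite -/(circle_dist _ _) => cr.
have pd1 : 0 <= p%:R ^+ d - 1 :> R by rewrite subr_ge0 exprn_ege1// ler1n ltnW.
have := le_trans rc (le_trans cr (ler_wpM2l pd1 dr)).
rewrite mulrC ler_pM2r// => /le_lt_trans -/(_ (p%:R ^+ d)).
by rewrite ltrBlDr ltrDl => /(_ ltr01); rewrite ltr_eXn2l// ltr1n.
Qed.

(** Multiplying by [p ^ N] turns a bound valid for all multipliers beyond [N] into
    one valid for all multipliers, because [p ^ N * q > N] for every [q > 0]. *)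
Lemma Ep_uniformly_bad x : Ep R p x ->
  exists2 c : R, 0 < c & exists k, uniformly_bad c (x *+ p ^ k).
Proof.
rewrite /Ep/= /mp limn_einf_lim.
set u := (X in einfs X) => u0.
have [N uN] : exists N, (0 < einfs u N)%E.
  apply: contrapT => /forallNP uN; move: u0; apply/negP; rewrite -leNgt.
  apply: lime_le; first exact: is_cvg_einfs.
  by apply: nearW => n; rewrite leNgt; apply/negP.
have [c c0 cu] : exists2 c : R, 0 < c & (c%:E <= einfs u N)%E.
  move: uN; case: (einfs u N) => [c|_|//]; last by exists 1; rewrite ?leey.
  by rewrite lte_fin => c0; exists c.
exists c => //; exists N => q q0.
have Np : (N < p ^ N)%N by rewrite ltn_expl ?prime_gt1.
have m0 : (0 < p ^ N * q)%N by rewrite muln_gt0 expn_gt0 prime_gt0.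
(* The quantity attached to [q] at the new point is the one attached to
   [p ^ N * q] at the old point. *)
rewrite -(weight_expM N _ q0) -mulrnA -lee_fin.
have -> : (weight (p ^ N * q) * circle_norm (x *+ (p ^ N * q)))%:E = u (p ^ N * q).-1.
  by rewrite /u prednK.
apply: le_trans cu _; apply: ereal_inf_lbound; exists (p ^ N * q).-1 => //=.
by rewrite -ltnS prednK// (leq_trans Np)// leq_pmulr.
Qed.

Lemma uniformly_bad_Ep c : 0 < c -> uniformly_bad c `<=` Ep R p.
Proof.
move=> c0 x bx; rewrite /Ep/= /mp limn_einf_lim.
apply: (@lt_le_trans _ _ c%:E) => //; apply: lime_ge; first exact: is_cvg_einfs.
apply: nearW => n; apply: le_ereal_inf_tmp => _ [m _ <-].
by rewrite lee_fin; apply: bx.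
Qed.

End uniformly_bad.

Arguments uniformly_bad {R} p c.

(** * The distribution function of an orbit *)

Section distribution.
Context {R : realType} {p : nat} (p_pr : prime p).
Context {c : R} (c0 : 0 < c) {x : circle R} (bx : uniformly_bad p c x).
Implicit Types (r s t v e : R) (k g : nat).

Definition orbit_cdf t : R :=
  upper_density (fun k => circle_coord (x *+ p ^ k) < t).

Lemma orbit_cdf_mono s t : s <= t -> orbit_cdf s <= orbit_cdf t.
Proof. by move=> st; apply: upper_density_sub => k /lt_le_trans; apply. Qed.

Lemma orbit_cdf0 : orbit_cdf 0 = 0.
Proof.
rewrite -[RHS](@upper_density0 R); congr upper_density; apply/funext => k.
by rewrite ltNge circle_coord_ge0.
Qed.

Lemma orbit_cdf1 : orbit_cdf 1 = 1.
Proof.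
rewrite -[RHS](@upper_densityT R); congr upper_density; apply/funext => k.
exact: circle_coord_lt1.
Qed.

(** If the orbit never meets [s, t[ the two sets of times coincide. *)
Lemma orbit_cdf_flat s t :
  (forall k, s <= circle_coord (x *+ p ^ k) -> t <= circle_coord (x *+ p ^ k)) ->
  orbit_cdf t <= orbit_cdf s.
Proof.
move=> st; apply: upper_density_sub => k; rewrite !unfold_in => kt.
by rewrite ltNge; apply/negP => /st; rewrite leNgt kt.
Qed.

(** The times spent in [s, t[ are separated by more than [g], by slow
    recurrence; they are the times gained when passing from [s] to [t]. *)
Lemma orbit_cdf_modulus r s t g : t - s <= r -> r * p%:R ^+ g <= c ->
  orbit_cdf t <= orbit_cdf s + g.+1%:R^-1.
Proof.
move=> tsr rc; pose C k := s <= circle_coord (x *+ p ^ k) < t.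
apply: (@upper_density_sparse _ _ _ C) => [k|k d /andP[sk kt] /andP[sd dt] d0].
  by rewrite /C => ->; rewrite andbT; case: leP.
apply: (uniformly_bad_return p_pr r k d g bx) => //.
  by apply: lt_le_trans tsr; rewrite subr_gt0 (le_lt_trans sk).
rewrite circle_dist_coord (le_trans (distZ_le_norm _))//.
move: sk kt sd dt; move: (circle_coord _) (circle_coord _) => a b sa at_ sb bt.
by rewrite ler_norml; apply/andP; split; lra.
Qed.

Lemma orbit_cdf_uniform e : 0 < e ->
  exists2 r, 0 < r & forall s t, t - s <= r -> orbit_cdf t <= orbit_cdf s + e.
Proof.
move=> e0; have pg g : 0 < p%:R ^+ g :> R by rewrite exprn_gt0// ltr0n prime_gt0.
have [g _ /(_ g (leqnn g))/= ge] := near_infty_natSinv_lt (PosNum e0).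
exists (c / p%:R ^+ g); first by rewrite divr_gt0.
move=> s t /orbit_cdf_modulus h; apply: le_trans (h g _) _.
  by rewrite divfK// gt_eqF.
by rewrite lerD2l ltW.
Qed.

(** The value [v] is attained at the last point [t] with [F t <= v], by continuity
    of [F].  By the choice of [t], [F] increases strictly at the right of [t], so
    the orbit visits every interval [t, t + e[ and [t] is in its closure. *)
Lemma orbit_cdf_surj v : 0 < v -> v < 1 ->
  exists2 z, uniformly_bad p c z & orbit_cdf (circle_coord z) = v.
Proof.
move=> v0 v1; pose S := [set s | orbit_cdf s <= v].
have S0 : S 0 by rewrite /S/= orbit_cdf0 ltW.
have S_lt1 s : S s -> s < 1.
  move=> Ss; rewrite ltNge; apply/negP => /orbit_cdf_mono.
  by rewrite orbit_cdf1 => /le_trans /(_ Ss); rewrite leNgt v1.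
have supS : has_sup S by split; [exists 0 | exists 1 => s /S_lt1/ltW].
pose t := sup S.
have t0 : 0 <= t by exact: ub_le_sup supS.2 _ S0.
have Ft_le : orbit_cdf t <= v.
  apply/ler_addgt0Pr => e /orbit_cdf_uniform[r r0 Fr].
  have [s Ss str] := sup_adherent r0 supS.
  apply: le_trans (Fr s t _) _; last by rewrite lerD2r.
  by rewrite -/t in str; lra.
have gt_t s : t < s -> v < orbit_cdf s.
  by move=> ts; rewrite ltNge; apply/negP => /(ub_le_sup supS.2); rewrite leNgt ts.
have Ft : orbit_cdf t = v.
  apply/eqP; rewrite eq_le Ft_le/=; apply/ler_addgt0Pr => e.
  move=> /orbit_cdf_uniform[r r0 Fr]; apply: le_trans (ltW (gt_t (t + r) _)) (Fr _ _ _).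
    by rewrite ltrDl.
  by rewrite addrAC subrr add0r.
exists (\pi_(circle R) t); last by rewrite circle_coord_pi// S_lt1.
apply: (uniformly_bad_closed p_pr) => e e0.
have [k /andP[tk kt]] : exists k, t <= circle_coord (x *+ p ^ k) < t + e.
  apply: contrapT => /forallNP no_visit.
  have : orbit_cdf (t + e) <= orbit_cdf t.
    apply: orbit_cdf_flat => k tk; rewrite leNgt; apply/negP => kt.
    by apply: (no_visit k); rewrite tk.
  by rewrite Ft leNgt gt_t// ltrDl.
exists (x *+ p ^ k); first exact: uniformly_bad_expM.
rewrite circle_dist_coord circle_coord_pi ?S_lt1// (le_trans (distZ_le_norm _))//.
by rewrite ger0_norm ?subr_ge0// lerBlDl ltW.
Qed.

End distribution.

(** * Comparison of its increments with the gauge *)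

Section gauge.
Context {R : realType} {p : nat} (p_pr : prime p).
Context {c : R} (c0 : 0 < c) {x : circle R} (bx : uniformly_bad p c x).
Context {h : R -> R} (hg : gauge_h1 h).

Lemma gauge_h1_ge0 r : 0 <= r -> 0 <= h r.
Proof.
have [_ _ h0 hpos] := hg.1.
by rewrite le_eqVlt => /predU1P[<-|/hpos/ltW//]; rewrite h0.
Qed.

(** The best [g] for a given [r] is the integer part of [log (c / r) / log p].  The
    constant [c] is absorbed by the factor [2]: the condition [r <= c ^ 2] says
    exactly that [log (c / r)] is at least half of [log (1 / r)]. *)
Lemma log_return_time r : 0 < r -> r <= c -> r <= c ^+ 2 -> r < 1 ->
  exists2 g, r * p%:R ^+ g <= c & g.+1%:R^-1 <= 2 * ln p%:R * (ln r^-1)^-1.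
Proof.
move=> r0 rc rc2 r1.
have p1 : 1 < p%:R :> R by rewrite ltr1n prime_gt1.
have p0 : 0 < p%:R :> R := lt_trans ltr01 p1.
have lnp : 0 < ln p%:R :> R := ln_gt0 p1.
have lnr : 0 < ln r^-1 by rewrite ln_gt0// invf_gt1.
have lncr : ln (c / r) = ln c + ln r^-1 by rewrite lnM// posrE ?invr_gt0.
have lncr0 : 0 <= ln (c / r) by rewrite ln_ge0// ler_pdivlMr// mul1r.
have half : ln r^-1 <= 2 * ln (c / r).
  have : ln r <= ln (c ^+ 2) by rewrite ler_ln// posrE exprn_gt0.
  by rewrite lncr lnXn// mulr2n lnV//; lra.
have Lge0 : 0 <= ln (c / r) / ln p%:R by rewrite divr_ge0// ltW.
have /andP[] := truncn_itv Lge0.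
move: (Num.truncn _) => g gL Lg; exists g.
  rewrite mulrC -ler_pdivlMr// -ler_ln ?posrE ?divr_gt0 ?exprn_gt0//.
  by rewrite lnXn// -[leLHS]mulr_natl -ler_pdivlMr.
rewrite ler_pdivlMr// mulrC ler_pdivrMr//.
apply: (le_trans half); rewrite -mulrA ler_pM2l// -ler_pdivrMl//.
by rewrite mulrC ltW.
Qed.

Lemma orbit_cdf_gauge : exists2 d : R, 0 < d &
  forall r s t, 0 <= r -> r <= d -> t - s <= r ->
    @orbit_cdf R p x t <= @orbit_cdf R p x s + 2 * ln p%:R * h r.
Proof.
have [_ _ h0 _] := hg.1.
exists (Num.min (Num.min c (c ^+ 2)) (expR (- 2))).
  by rewrite !lt_min c0 exprn_gt0// expR_gt0.
move=> r s t; rewrite !le_min => + /andP[/andP[rc rc2] re] tsr.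
rewrite le_eqVlt => /predU1P[rE|r0].
  rewrite -rE h0 mulr0 addr0; apply: orbit_cdf_mono.
  by rewrite -subr_le0 rE.
have re1 : r < expR (- 1) by rewrite (le_lt_trans re)// ltr_expR; lra.
have r1 : r < 1 by rewrite (lt_trans re1)// -expR0 ltr_expR; lra.
have [g rg gr] := log_return_time r r0 rc rc2 r1.
rewrite (le_trans (orbit_cdf_modulus p_pr bx _ _ _ _ tsr rg))// lerD2l.
by rewrite hg.2// r0.
Qed.

End gauge.

(** * A mass distribution principle *)

Section hausdorff_general.
Context {R : realType} {T : metricType R}.
Implicit Types (A E : set T) (h : R -> R).
Local Open Scope ereal_scope.

Lemma diam_ge0 A : 0 <= diam A.
Proof. by apply: ereal_sup_ubound; left. Qed.

Lemma mdist_le_diam A (x y : T) : A x -> A y -> (mdist x y)%:E <= diam A.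
Proof. by move=> Ax Ay; apply: ereal_sup_ubound; right; exists x => //; exists y. Qed.

(** The premeasure increases as the scale decreases, so its limit at zero is its
    supremum over small scales. *)
Lemma hausdorff_measure_ge h E (a : \bar R) (d : R) : (0 < d)%R ->
  a <= hausdorff_premeasure h d E -> a <= hausdorff_measure h E.
Proof.
move=> d0 ad.
have mono : {in Interval (BRight 0%R) (BLeft (d + 1)%R) &,
    nonincreasing_fun (fun r : R => hausdorff_premeasure h r E)}.
  move=> r s _ _ rs; apply: ereal_inf_le_tmp => _ [U [EU Ur] <-].
  by exists U => //; split=> // i; rewrite (le_trans (Ur i))// lee_fin.
rewrite /hausdorff_measure.
have d1 : (BRight 0%R < BLeft (d + 1)%R)%O by rewrite bnd_simp addr_gt0.
rewrite (cvg_lim _ (nonincreasing_at_right_cvge _ d1 mono))//.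
apply: (le_trans ad); apply: ereal_sup_ubound; exists d => //=.
by rewrite in_itv/= d0 ltrDl ltr01.
Qed.

End hausdorff_general.

Section mass_distribution.
Context {R : realType}.

Lemma lebesgue_measure_itv_radius (a L : R) : 0 <= L ->
  lebesgue_measure (`[a - L, a + L] : set R) = (L *+ 2)%:E.
Proof.
move=> L0; rewrite lebesgue_measure_itv/= lte_fin -EFinB.
by case: ltP => aL; congr EFin; lra.
Qed.

(** If the increments of [G] are controlled by [h], the image of a piece of
    a cover lies in few intervals whose lengths are controlled by [h] of its
    diameter, and Lebesgue measure is countably subadditive.  Each piece is cut
    into its parts with coordinates below and above one half, so as not to wrap
    around [0], and each part has its image in an interval of radius [a * h r];
    whence the constant [4 = 2 * 2]. *)
Lemma mass_distribution (E : set (circle R)) (G : circle R -> R) (h : R -> R)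
    (a d : R) :
  0 < a -> (forall r, 0 <= r -> 0 <= h r) ->
  (forall r y z, 0 <= r -> r <= d -> circle_coord y - circle_coord z <= r ->
     G y <= G z + a * h r) ->
  `]0, 1[ `<=` G @` E ->
  ((4 * a)^-1%:E <= hausdorff_premeasure h d E)%E.
Proof.
move=> a0 h0 Gmod surj; apply: le_ereal_inf_tmp => _ [U [EU Ud] <-].
pose r i := fine (diam (U i)).
have rE i : (r i)%:E = diam (U i).
  by rewrite fineK// ge0_fin_numE ?diam_ge0// (le_lt_trans (Ud i))// ltry.
have r0 i : 0 <= r i by rewrite -lee_fin rE diam_ge0.
have rd i : r i <= d by rewrite -lee_fin rE.
pose L i := a * h (r i).
have L0 i : 0 <= L i by rewrite mulr_ge0 ?h0// ltW.
pose half i b := U i `&` [set z | (circle_coord z < 1 / 2) = b].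
(* The centre of the interval is the value of [G] at any point of the part; the
   default [0] is used only for empty parts. *)
pose m i b := G (xget 0 (half i b)).
pose V i b : set R := `[m i b - L i, m i b + L i]%classic.
have mV i b : measurable (V i b : set (measurableTypeR R)) by exact: measurable_itv.
have halfV i b z : half i b z -> V i b (G z).
  move=> hz; have [Uw hw] := xgetPex 0 (ex_intro _ z hz).
  have [Uz bz] := hz; rewrite /V/= in_itv/= /m.
  move: (xget _ _) Uw hw => w Uw /= bw.
  have zw : `|circle_coord z - circle_coord w| <= 1 / 2.
    have := circle_coord_ge0 z; have := circle_coord_lt1 z.
    have := circle_coord_ge0 w; have := circle_coord_lt1 w.
    move: bz bw => /=; move: (circle_coord z) (circle_coord w) => s t.
    move=> <-; case: ltP => h1; case: ltP => h2 // _ s0 s1 t0 t1;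
      by rewrite ler_norml; apply/andP; split; lra.
  have := mdist_le_diam (U i) z w Uz Uw.
  rewrite -rE lee_fin circle_dist_coord distZ_half// => zwr.
  have wzr := zwr; rewrite distrC in wzr.
  rewrite lerBlDr.
  by rewrite !Gmod ?(le_trans (ler_norm _) zwr) ?(le_trans (ler_norm _) wzr).
have cover : `]0, 1[ `<=` \bigcup_i (V i true `|` V i false).
  move=> v /surj[z /EU[i _ Uz] <-]; exists i => //.
  by case b : (circle_coord z < 1 / 2); [left|right]; apply: halfV.
have mVU i : measurable (V i true `|` V i false : set (measurableTypeR R)).
  exact: measurableU.
have mI : measurable (`]0, 1[%classic : set (measurableTypeR R)).
  exact: measurable_itv.
have := @measure_sigma_subadditive _ R _ (@lebesgue_measure R) _ _ mVU mI cover.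
move=> /(le_trans _)-/(_ 1%:E) one_le.
have {one_le} : (1 <= \sum_(i <oo) (4 * a)%:E * (h (r i))%:E)%E.
  apply: le_trans (one_le _) _.
    by rewrite [leRHS]lebesgue_measure_itv/= lte_fin ltr01 sube0.
  apply: lee_nneseries => [i _ _|i _].
    exact: measure_ge0.
  have := @measureU2 _ _ _ (@lebesgue_measure R) _ _ (mV i true) (mV i false).
  move=> /le_trans; apply.
  have VE b : (lebesgue_measure (V i b) <= (L i *+ 2)%:E)%E.
    by rewrite [leLHS](lebesgue_measure_itv_radius (m i b) (L i)).
  apply: le_trans (leeD (VE true) (VE false)) _.
  by rewrite -EFinD -EFinM lee_fin /L; lra.
rewrite nneseriesZl => [|i _]; last by rewrite lee_fin h0.
by rewrite -lee_pdivrMl// ?mulr_gt0// mule1.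
Qed.

End mass_distribution.

(** * The exceptional set *)

(** Through the logistic function. *)
Lemma card_unit_interval (R : realType) : ([set: R] #<= (`]0, 1[ : set R))%card.
Proof.
pose f (t : R) := (1 + expR t)^-1.
have f_inj : {in [set: R] &, injective f}.
  by move=> s t _ _ /invr_inj/addrI/expR_inj.
apply: card_le_trans (_ : (f @` [set: R] #<= _)%card); last first.
  apply: subset_card_le => _ [t _ <-]; have := expR_gt0 t => t0.
  by rewrite /= in_itv/= invr_gt0 invf_lt1 ?addr_gt0// ltrDl t0.
by have /card_eqPle[] := inj_card_eq f_inj.
Qed.

Theorem corollary2p3 (R : realType) (p : nat) (h1 : R -> R) :
  prime p -> gauge_h1 h1 -> Ep R p !=set0 ->
  (0 < hausdorff_measure h1 (Ep R p))%E /\ (Ep R p #= [set: R])%card.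
Proof.
move=> p_pr hg [y0 /(Ep_uniformly_bad p_pr)[c c0 [k]]].
move: (y0 *+ p ^ k) => x bx.
pose G (z : circle R) := orbit_cdf (p := p) (x := x) (circle_coord z).
have surj : `]0, 1[ `<=` G @` Ep R p.
  move=> v /=; rewrite in_itv/= => /andP[v0 v1].
  have [z bz zv] := orbit_cdf_surj p_pr c0 bx v v0 v1.
  by exists z => //; exact: uniformly_bad_Ep bz.
split.
  have [d d0 Gmod] := orbit_cdf_gauge p_pr c0 bx hg.
  have lnp : 0 < ln p%:R :> R by rewrite ln_gt0// ltr1n prime_gt1.
  have a0 : 0 < 2 * ln p%:R :> R by rewrite mulr_gt0.
  have := mass_distribution _ G h1 _ d a0 (gauge_h1_ge0 hg) _ surj.
  move=> /(_ (fun r y z r0 rd yz => Gmod r _ _ r0 rd yz)).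
  move=> /(hausdorff_measure_ge _ _ _ _ d0); apply: lt_le_trans.
  by rewrite lte_fin invr_gt0 mulr_gt0.
apply/card_eqPle; split.
  apply: card_le_trans (_ : (_ #<= @circle_coord R @` Ep R p)%card) _.
    have inj : {in Ep R p &, injective (@circle_coord R)}.
      by move=> y z _ _ yz; rewrite -(circle_coordK y) yz circle_coordK.
    by have /card_eqPle[] := inj_card_eq inj.
  exact: card_leT.
apply: card_le_trans (card_unit_interval R) _.
exact: card_le_trans (subset_card_le surj) (card_image_le _ _).
Qed.
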